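(* Let $\mathcal O$ be the ring of integers of a finite extension of $\mathbb{Q}_p$, with maximal ideal $\mathfrak m$ of ramification index $e\le p-1$ over $\mathbb{Z}_p$ and residue field $\mathbb F$. Let $M,N$ be $\mathcal O[T]$-modules which are free of the same finite rank $d$ as $\mathcal O$-modules. Then $(M\otimes_{\mathcal O}\mathbb F)^{ss}\cong(N\otimes_{\mathcal O}\mathbb F)^{ss}$ as $\mathbb F[T]$-modules if and only if for all $n$ with $1\le n\le d$, $$\operatorname{tr}(T^n\mid M)\equiv\operatorname{tr}(T^n\mid N)\pmod{n\mathfrak m}.$$
   Context: $V^{ss}$ denotes the semisimplification of a finite-dimensional $\mathbb F[T]$-module $V$ (the direct sum of the composition factors). $n\mathfrak m=\{na:a\in\mathfrak m\}$. *)

(* Defs.v *)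
From HB Require Import structures.
From mathcomp Require Import all_boot all_order all_algebra all_fingroup.
From mathcomp Require Import mxrepresentation.
Set Implicit Arguments. Unset Strict Implicit. Unset Printing Implicit Defensive.
Import Order.TTheory GRing.Theory Num.Theory.
Local Open Scope ring_scope.

(* O is the ring of integers of a finite extension of Q_p, i.e. a complete    *)
(* discrete valuation ring of characteristic 0 with finite residue field of    *)
(* characteristic p.  pi is a uniformizer, m = pi O, red : O -> F is the       *)
(* reduction map onto the residue field F = O/m, and e is the ramification    *)
(* index (p = unit * pi^e).                                                   *)

Definition char0 (O : idomainType) : Prop :=
  forall k : nat, (k%:R : O) = 0 -> k = 0%N.

Definition is_uniformizer_dvr (O : idomainType) (pi : O) : Prop :=
  [/\ pi != 0, pi \isn't a GRing.unit &
      forall x : O, x != 0 ->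
        exists u : O, exists k : nat, u \is a GRing.unit /\ x = u * pi ^+ k].

Definition pi_adically_complete (O : idomainType) (pi : O) : Prop :=
  forall a : nat -> O,
    (forall n, exists y, a n.+1 - a n = pi ^+ n * y) ->
    exists l : O, forall n, exists y, l - a n = pi ^+ n * y.

Definition is_residue_map (O : idomainType) (F : fieldType)
    (red : {rmorphism O -> F}) (pi : O) : Prop :=
  (forall z : F, exists x : O, red x = z) /\
  (forall x : O, red x = 0 <-> exists y, x = pi * y).

Definition padic_integer_ring (O : idomainType) (F : finFieldType)
    (red : {rmorphism O -> F}) (pi : O) (p e : nat) : Prop :=
  [/\ char0 O, is_uniformizer_dvr pi, pi_adically_complete pi,
      is_residue_map red pi &
      [/\ prime p, (p%:R : F) = 0 &
        exists u : O, u \is a GRing.unit /\ (p%:R : O) = u * pi ^+ e]].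

(* A matrix A : 'M[F]_n represents the F[T]-module F^n (row vectors), with T  *)
(* acting by v |-> v *m A.                                                    *)

Definition stablemod (F : fieldType) n (U A : 'M[F]_n) : bool :=
  (U *m A <= U)%MS.

(* action of T on the submodule U (in the basis row_base U) *)
Definition sub_action (F : fieldType) n (U A : 'M[F]_n) : 'M[F]_(\rank U) :=
  in_submod U (@val_submod F n U _ 1%:M *m A).

Definition fact_action (F : fieldType) n (U A : 'M[F]_n)
    : 'M[F]_(\rank (cokermx U)) :=
  in_factmod U (@val_factmod F n U _ 1%:M *m A).

Definition simplemod (F : fieldType) n (A : 'M[F]_n) : Prop :=
  (0 < n)%N /\
  forall U : 'M[F]_n, stablemod U A -> (\rank U == 0)%N || (\rank U == n).

Inductive comp_factors (F : fieldType) :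
    forall n, 'M[F]_n -> seq {m : nat & 'M[F]_m} -> Prop :=
| CF0 (A : 'M[F]_0) : comp_factors A [::]
| CFsimple n (A : 'M[F]_n) : simplemod A -> comp_factors A [:: existT _ n A]
| CFext n (A U : 'M[F]_n) L1 L2 :
    stablemod U A -> (0 < \rank U < n)%N ->
    comp_factors (sub_action U A) L1 ->
    comp_factors (fact_action U A) L2 ->
    comp_factors A (L1 ++ L2).

Definition dsum_mods (F : fieldType) (L : seq {m : nat & 'M[F]_m})
    : {m : nat & 'M[F]_m} :=
  foldr (fun X S => existT (fun m => 'M[F]_m) (tag X + tag S)%N
                      (block_mx (tagged X) 0 0 (tagged S)))
        (existT (fun m => 'M[F]_m) 0%N 0) L.

Definition mod_iso (F : fieldType) a b (X : 'M[F]_a) (Y : 'M[F]_b) : Prop :=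
  exists P : 'M[F]_(a, b), [/\ row_free P, row_full P & X *m P = P *m Y].

Definition is_semisimplification (F : fieldType) n (A : 'M[F]_n)
    (S : {m : nat & 'M[F]_m}) : Prop :=
  exists L, comp_factors A L /\ S = dsum_mods L.

Definition ss_iso (F : fieldType) n1 n2 (A : 'M[F]_n1) (B : 'M[F]_n2) : Prop :=
  exists SA SB, [/\ is_semisimplification A SA, is_semisimplification B SB &
                    mod_iso (tagged SA) (tagged SB)].

(* Main.v *)
Require Import Defs.
From HB Require Import structures.
From mathcomp Require Import all_boot all_order all_algebra.
From mathcomp Require Import perm mxrepresentation ring zify.
Set Implicit Arguments. Unset Strict Implicit. Unset Printing Implicit Defensive.
Import Order.TTheory GRing.Theory Num.Theory.
Local Open Scope ring_scope.

(**
Over a field, the semisimplification of the F[T]-module given by a matrix is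
determined by its characteristic polynomial: a simple module is cyclic, hence
isomorphic to F[T]/(chi) with chi irreducible, and the composition factors are
read off the factorisation of the characteristic polynomial.

For the traces, write the reversed characteristic polynomial of A as a product
of factors 1 - x_m t^m (1 <= m <= d) modulo t^(d+1).  The "Witt coordinates" x_m
are integral polynomials in the coefficients and conversely, so the reductions
of the characteristic polynomials of A and B agree if and only if x_m = y_m mod
pi for all m <= d.  Taking logarithmic derivatives, Newton's identities become
tr(A^n) = sum_(m k = n) m x_m^k.  Since e <= p - 1, x = y mod pi implies
x^k = y^k mod k pi, and an induction on n shows that the congruences of the
coordinates modulo pi are equivalent to those of tr(A^n) modulo n pi.
*)

(** * Modules over F[T] and characteristic polynomials *)

Section ModuleIso.
Variable F : fieldType.

Lemma mod_isoP a b (X : 'M[F]_a) (Y : 'M[F]_b) :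
  mod_iso X Y <-> exists P : 'M_(a, b), exists Q : 'M_(b, a),
    [/\ P *m Q = 1%:M, Q *m P = 1%:M & X *m P = P *m Y].
Proof.
split=> [[P [free_P full_P eXY]]|[P [Q [PQ QP eXY]]]].
  by exists P, (pinvmx P); rewrite mulmxVp // mulVpmx.
by exists P; split=> //; [apply/row_freeP | apply/row_fullP]; exists Q.
Qed.

Lemma mod_iso_refl a (X : 'M[F]_a) : mod_iso X X.
Proof. by apply/mod_isoP; exists 1%:M, 1%:M; rewrite !mulmx1 mul1mx. Qed.

Lemma mod_iso_trans a b c (X : 'M[F]_a) (Y : 'M[F]_b) (Z : 'M[F]_c) :
  mod_iso X Y -> mod_iso Y Z -> mod_iso X Z.
Proof.
move=> /mod_isoP[P [P' [PP' P'P eXY]]] /mod_isoP[Q [Q' [QQ' Q'Q eYZ]]].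
apply/mod_isoP; exists (P *m Q), (Q' *m P'); split.
- by rewrite mulmxA -(mulmxA P) QQ' mulmx1.
- by rewrite mulmxA -(mulmxA Q') P'P mulmx1.
- by rewrite mulmxA eXY -!mulmxA eYZ.
Qed.

Lemma mod_iso_block a b c d (X : 'M[F]_a) (Y : 'M[F]_b)
    (X' : 'M[F]_c) (Y' : 'M[F]_d) :
  mod_iso X X' -> mod_iso Y Y' ->
  mod_iso (block_mx X 0 0 Y) (block_mx X' 0 0 Y').
Proof.
move=> /mod_isoP[P [P' [PP' P'P eX]]] /mod_isoP[Q [Q' [QQ' Q'Q eY]]].
apply/mod_isoP; exists (block_mx P 0 0 Q), (block_mx P' 0 0 Q').
rewrite !mulmx_block !(mulmx0, mul0mx, addr0, add0r) PP' P'P QQ' Q'Q eX eY.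
by rewrite -!scalar_mx_block.
Qed.

Lemma mod_iso_blockCA a b c (X : 'M[F]_a) (Y : 'M[F]_b) (Z : 'M[F]_c) :
  mod_iso (block_mx X 0 0 (block_mx Y 0 0 Z))
          (block_mx Y 0 0 (block_mx X 0 0 Z)).
Proof.
(* The block permutation matrix exchanging the first two summands; its inverse has the same shape
   with [a] and [b] swapped. *)
pose P a b : 'M[F]_(a + (b + c), b + (a + c)) :=
  block_mx 0 (row_mx 1%:M 0) (col_mx 1%:M 0) (block_mx 0 0 0 1%:M).
have PP a' b' : P a' b' *m P b' a' = 1%:M.
  rewrite mulmx_block !(mulmx0, mul0mx, addr0, add0r) mul_row_col mul_col_row.
  rewrite mul_row_block mul_block_col mulmx_block add_block_mx.
  rewrite !(mulmx0, mul0mx, addr0, add0r, mulmx1) row_mx0 col_mx0.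
  by rewrite -!scalar_mx_block.
apply/mod_isoP; exists (P a b), (P b a); split; rewrite ?PP //.
rewrite !mulmx_block !(mulmx0, mul0mx, addr0, add0r).
rewrite mul_mx_row mul_row_block mul_block_col mul_col_mx.
by rewrite !(mulmx0, mul0mx, addr0, add0r, mulmx1, mul1mx).
Qed.

Lemma char_poly_block a b (X : 'M[F]_a) C (Y : 'M[F]_b) :
  char_poly (block_mx X 0 C Y) = char_poly X * char_poly Y.
Proof.
rewrite /char_poly /char_poly_mx scalar_mx_block map_block_mx opp_block_mx.
by rewrite add_block_mx raddf0 oppr0 addr0 det_lblock.
Qed.

Lemma mod_iso_char_poly a b (X : 'M[F]_a) (Y : 'M[F]_b) :
  mod_iso X Y -> char_poly X = char_poly Y.
Proof.
case=> P [free_P full_P eXY].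
have eab : a = b by rewrite -(eqP free_P); apply/eqP.
case: b / eab Y P free_P full_P eXY => Y P free_P _ eXY.
have detP : (\det (map_mx polyC P)) != 0.
  by rewrite det_map_mx polyC_eq0 -unitfE -unitmxE -row_free_unit.
apply: (mulIf detP); rewrite /char_poly -det_mulmx mulrC -det_mulmx.
congr (\det _); rewrite /char_poly_mx mulmxBl mulmxBr scalar_mxC.
by rewrite -!map_mxM eXY.
Qed.

(** A basis of [U] followed by one of a complement makes the action block lower triangular, with the
    two actions on the diagonal; stability of [U] gives the zero block. *)
Lemma char_poly_stable n (U A : 'M[F]_n) : stablemod U A ->
  char_poly A = char_poly (sub_action U A) * char_poly (fact_action U A).
Proof.
move=> stU.
pose C := in_submod U (@val_factmod F n U _ 1%:M *m A).
rewrite -(char_poly_block _ C); apply/esym/mod_iso_char_poly.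
pose P := col_mx (@val_submod F n U _ 1%:M) (@val_factmod F n U _ 1%:M).
have full_P : row_full P.
  apply/row_fullP; exists (row_mx (in_submod U 1%:M) (in_factmod U 1%:M)).
  by rewrite mul_row_col -val_submodE -val_factmodE add_sub_fact_mod.
exists P; split=> //.
  rewrite /row_free (eqP full_P) mxrank_coker subnKC //; exact: rank_leq_col.
rewrite mul_block_col mul0mx addr0 mul_col_mx.
rewrite -!val_submodE -val_factmodE add_sub_fact_mod in_submodK //.
exact: submx_trans (submxMr _ (val_submodP _)) stU.
Qed.

End ModuleIso.

(** * Simple modules: cyclic vectors and irreducible characteristic polynomials *)

Section SimpleModules.
Variable F : fieldType.

Definition krylov n (A : 'M[F]_n) (v : 'rV_n) : 'M_n :=
  \matrix_(i < n) (v *m A ^+ i).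

Lemma mul_krylov n (A : 'M[F]_n.+1) v u :
  u *m krylov A v = v *m horner_mx A (rVpoly u).
Proof.
rewrite mulmx_sum_row /rVpoly poly_def raddf_sum mulmx_sumr.
apply: eq_bigr => i _; rewrite rowK valK /= horner_mxZ /= rmorphXn /= horner_mx_X.
by rewrite -scalemxAr.
Qed.

(* matrix of multiplication by ['X] on F['X]/(q) *)
Definition mulX_mod_mx n (q : {poly F}) : 'M[F]_n :=
  \matrix_(i < n) poly_rV ('X^(i.+1) %% q).

(** By Cayley-Hamilton, [v *m A ^+ i.+1] depends only on X^(i+1) modulo [char_poly A]. Hence Krylov
    spaces are stable, and an invertible Krylov matrix identifies the module with F[X]/(chi). *)
Lemma krylov_mulX n (A : 'M[F]_n.+1) v :
  krylov A v *m A = mulX_mod_mx _ (char_poly A) *m krylov A v.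
Proof.
apply/row_matrixP => i; rewrite !row_mul !rowK mul_krylov poly_rV_K; last first.
  rewrite -ltnS -(size_char_poly A) ltn_modp.
  exact: monic_neq0 (char_poly_monic A).
have := divp_eq 'X^(i.+1) (char_poly A) => /(congr1 (horner_mx A)).
rewrite rmorphD rmorphM /= Cayley_Hamilton mulr0 add0r => <-.
by rewrite rmorphXn /= horner_mx_X exprSr mulmxA.
Qed.

Lemma simplemod_krylov n (A : 'M[F]_n.+1) : simplemod A ->
  exists v, krylov A v \in unitmx.
Proof.
case=> _ simA; pose v : 'rV[F]_n.+1 := delta_mx 0 0; exists v.
have /simA : stablemod (krylov A v) A by rewrite /stablemod krylov_mulX submxMl.
rewrite -row_free_unit => /orP[|//]; rewrite mxrank_eq0 => /eqP K0.
have /matrixP/(_ 0 0) : row 0 (krylov A v) = 0 by rewrite K0 row0.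
rewrite rowK expr0 mulmx1 !mxE !eqxx => /eqP; by rewrite oner_eq0.
Qed.

Lemma simplemod_iso n n' (A : 'M[F]_n) (B : 'M[F]_n') :
  simplemod A -> simplemod B -> char_poly A = char_poly B -> mod_iso A B.
Proof.
move=> simA simB eAB.
have enn' : n = n' by apply: succn_inj; rewrite -(size_char_poly A) eAB size_char_poly.
case: n' / enn' B simB eAB => B simB eAB.
case: n A B simA simB eAB => [|n] A B simA simB eAB; first by case: simA.
have [v uv] := simplemod_krylov simA; have [w uw] := simplemod_krylov simB.
set K := krylov A v in uv; set L := krylov B w in uw.
apply/mod_isoP; exists (invmx K *m L), (invmx L *m K); split.
- by rewrite mulmxA mulmxK // mulVmx.
- by rewrite mulmxA mulmxK // mulVmx.
apply: (can_inj (mulKmx uv)); rewrite !mulmxA mulmxV // mul1mx.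
by rewrite !krylov_mulX mulmxK // eAB.
Qed.

(** For a cyclic vector [v], the coefficients of a small annihilating polynomial form a row killed
    by the invertible [krylov A v]. *)
Lemma simplemod_annihilator n (A : 'M[F]_n.+1) (q : {poly F}) :
  simplemod A -> horner_mx A q = 0 -> q != 0 -> (n.+1 < size q)%N.
Proof.
move=> /simplemod_krylov[v uv] qA; apply: contraNltn => sq.
have : poly_rV q *m krylov A v = 0 by rewrite mul_krylov poly_rV_K // qA mulmx0.
move/(canRL (mulmxK uv)); rewrite mul0mx => q0.
by rewrite -(poly_rV_K sq) q0 raddf0.
Qed.

(** If chi = r q, the kernel of q(A) is a submodule, hence zero or everything. If zero, r(A) = 0
    although r has too small a degree; if everything, q(A) = 0 forces q to have full degree. *)
Lemma simplemod_irreducible n (A : 'M[F]_n) :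
  simplemod A -> irreducible_poly (char_poly A).
Proof.
case: n A => [|n] A simA; first by case: simA.
split=> [|q sq1 q_dvd]; first by rewrite size_char_poly.
have chi0 : char_poly A != 0 := monic_neq0 (char_poly_monic A).
have /dvdpP[r er] := q_dvd.
have [r0 q0] : r != 0 /\ q != 0.
  by move: chi0; rewrite er mulf_eq0 negb_or => /andP.
have rqA : horner_mx A r *m horner_mx A q = 0.
  by rewrite mulmxE -rmorphM /= -er Cayley_Hamilton.
have stU : stablemod (kermx (horner_mx A q)) A.
  apply/sub_kermxP; rewrite -mulmxA.
  have -> : A *m horner_mx A q = horner_mx A q *m A.
    by rewrite !mulmxE -{1 4}(horner_mx_X A) -!rmorphM mulrC.
  by rewrite mulmxA mulmx_ker mul0mx.
have [_ /(_ _ stU)] := simA; rewrite mxrank_ker subn_eq0 => /orP[rk|].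
  have uq : horner_mx A q \in unitmx by rewrite -row_full_unit -col_leq_rank.
  have rA : horner_mx A r = 0 by rewrite -[LHS](mulmxK uq) rqA mul0mx.
  have := simplemod_annihilator simA rA r0.
  have := size_char_poly A; rewrite er size_mul // => e1 lt_r.
  case/eqP: sq1; move: q0 e1 lt_r; rewrite -size_poly_gt0.
  by move: (size r) (size q) => a b; lia.
move=> rk; have /eqP rk0 : \rank (horner_mx A q) == 0%N.
  by have := rank_leq_row (horner_mx A q); lia.
have qA : horner_mx A q = 0 by apply/eqP; rewrite -mxrank_eq0 rk0.
have := simplemod_annihilator simA qA q0 => lt_q.
rewrite -(dvdp_size_eqp q_dvd) eqn_leq dvdp_leq //=.
by rewrite size_char_poly.
Qed.

End SimpleModules.

(** * Composition factors and unique factorisation *)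

Section CompositionFactors.
Variable F : fieldType.
Implicit Types L : seq {m : nat & 'M[F]_m}.

Definition all_simple L := foldr (fun X Q => simplemod (tagged X) /\ Q) True L.

Lemma all_simple_cat L1 L2 : all_simple (L1 ++ L2) <-> all_simple L1 /\ all_simple L2.
Proof. by elim: L1 => [|X L1 IH] /=; [tauto|rewrite IH; tauto]. Qed.

Definition char_prod L := \prod_(X <- L) char_poly (tagged X).

Lemma comp_factors_char_poly n (A : 'M[F]_n) L :
  comp_factors A L -> char_poly A = char_prod L /\ all_simple L.
Proof.
elim=> {n A L} [A|n A simA|n A U L1 L2 stU _ _ [e1 s1] _ [e2 s2]].
- by rewrite /char_prod big_nil /char_poly det_mx00.
- by rewrite /char_prod big_seq1.
split; last exact/all_simple_cat.
by rewrite (char_poly_stable stU) e1 e2 /char_prod big_cat.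
Qed.

Lemma char_poly_dsum L : char_poly (tagged (dsum_mods L)) = char_prod L.
Proof.
rewrite /char_prod; elim: L => [|X L IH] /=.
  by rewrite big_nil /char_poly det_mx00.
by rewrite char_poly_block IH big_cons.
Qed.

Lemma irreducible_dvd_char_prod q L : irreducible_poly q -> q %| char_prod L ->
  exists L1 X L2, L = L1 ++ X :: L2 /\ q %| char_poly (tagged X).
Proof.
move=> irr_q; rewrite /char_prod; elim: L => [|X L IH].
  by rewrite big_nil dvdp1 => /eqP e1; case: irr_q; rewrite e1.
rewrite big_cons; have [q_X _|q_X] := boolP (q %| char_poly (tagged X)).
  by exists [::], X, L.
rewrite Gauss_dvdpr ?irreducible_poly_coprime // => /IH[L1 [Y [L2 [-> q_Y]]]].
by exists (X :: L1), Y, L2.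
Qed.

Lemma dsum_mods_move L1 X L2 :
  mod_iso (tagged (dsum_mods (X :: L1 ++ L2))) (tagged (dsum_mods (L1 ++ X :: L2))).
Proof.
elim: L1 => [|Y L1 IH]; first exact: mod_iso_refl.
apply: mod_iso_trans (mod_iso_blockCA _ _ _) _.
exact: mod_iso_block (mod_iso_refl _) IH.
Qed.

(** The irreducible polynomial of the head of [L1] divides, hence equals, that of some member of
    [L2]; this member is moved to the front, matched by [simplemod_iso], and its factor
    cancelled. *)
Lemma all_simple_iso L1 L2 : all_simple L1 -> all_simple L2 ->
  char_prod L1 = char_prod L2 ->
  mod_iso (tagged (dsum_mods L1)) (tagged (dsum_mods L2)).
Proof.
elim: L1 L2 => [|X L1 IH] L2 /=.
  case: L2 => [|Y L2]; first by move=> *; apply: mod_iso_refl.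
  move=> _ [simY _]; rewrite /char_prod big_nil big_cons => /esym e1.
  have [+ _] := simplemod_irreducible simY.
  have : char_poly (tagged Y) %| 1 by rewrite -e1 dvdp_mulr.
  by rewrite dvdp1 => /eqP->.
move=> [simX sim1] sim2 e12.
have irrX := simplemod_irreducible simX.
have : char_poly (tagged X) %| char_prod L2.
  by rewrite -e12 /char_prod big_cons dvdp_mulr.
case/(irreducible_dvd_char_prod irrX) => M1 [Y [M2 [e2 X_Y]]]; subst L2.
move: sim2; rewrite all_simple_cat /= => -[simM1 [simY simM2]].
have eXY : char_poly (tagged X) = char_poly (tagged Y).
  apply/eqP; rewrite -eqp_monic ?char_poly_monic //.
  apply: (simplemod_irreducible simY).2 X_Y.
  by rewrite neq_ltn irrX.1 orbT.
apply: mod_iso_trans (dsum_mods_move M1 Y M2).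
apply: mod_iso_block; first exact: simplemod_iso.
apply: IH => //; first exact/all_simple_cat.
have X0 := monic_neq0 (char_poly_monic (tagged X)).
apply: (mulfI X0); move: e12; rewrite /char_prod big_cons => ->.
by rewrite !big_cat big_cons /= eXY mulrCA.
Qed.

End CompositionFactors.

Lemma comp_factors_exist (F : finFieldType) n (A : 'M[F]_n) :
  exists L, comp_factors A L.
Proof.
elim/ltn_ind: n A => -[|n] IH A; first by exists [::]; constructor.
(* Finiteness of [F] lets the existence of a proper nonzero submodule be decided by enumeration. *)
have [/existsP[U /and3P[stU rk0 rkn]]|noU] := boolP [exists U : 'M[F]_n.+1,
    [&& stablemod U A, (0 < \rank U)%N & (\rank U < n.+1)%N]].
  have [|L1 h1] := IH _ _ (sub_action U A); first by [].
  have [|L2 h2] := IH _ _ (fact_action U A).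
    by rewrite mxrank_coker; lia.
  by exists (L1 ++ L2); apply: CFext h1 h2; rewrite // rk0.
exists [:: existT (fun m => 'M[F]_m) n.+1 A]; constructor; split=> // U stU.
move: noU; rewrite negb_exists => /forallP/(_ U); rewrite stU /=.
have := rank_leq_row U; lia.
Qed.

Theorem ss_iso_char_poly (F : finFieldType) n1 n2 (A : 'M[F]_n1) (B : 'M[F]_n2) :
  ss_iso A B <-> char_poly A = char_poly B.
Proof.
split=> [[_ [_ [[LA [cA ->]] [LB [cB ->]] /mod_iso_char_poly]]]|eAB].
  have [-> _] := comp_factors_char_poly cA; have [-> _] := comp_factors_char_poly cB.
  by rewrite !char_poly_dsum.
have [LA cA] := comp_factors_exist A; have [LB cB] := comp_factors_exist B.
have [eA sA] := comp_factors_char_poly cA; have [eB sB] := comp_factors_char_poly cB.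
exists (dsum_mods LA), (dsum_mods LB); split; [by exists LA|by exists LB|].
by apply: all_simple_iso; rewrite // -eA -eB.
Qed.

(** * Newton's identities *)

Section MatrixPolynomials.
Variable R : comNzRingType.

Lemma deriv_prod (I : finType) (f : I -> {poly R}) :
  (\prod_i f i)^`() = \sum_i (f i)^`() * \prod_(j | j != i) f j.
Proof.
suff H (r : seq I) : uniq r ->
    (\prod_(i <- r) f i)^`() =
    \sum_(i <- r) (f i)^`() * \prod_(j <- r | j != i) f j.
  by rewrite H ?index_enum_uniq.
elim: r => [|k r IH] /=; first by rewrite !big_nil -[1]/(1%:P) derivC.
case/andP=> kr ur; rewrite !big_cons derivM IH // eqxx /=; congr (_ * _ + _).
  rewrite !big_seq [RHS]big_seq_cond; apply: eq_bigl => j.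
  case: (boolP (j \in r)) => //= jr.
  by apply/esym; apply: contraNneq kr => <-.
rewrite mulr_sumr big_seq [RHS]big_seq; apply: eq_bigr => i ir.
rewrite big_cons ifT; first by rewrite mulrCA.
by apply: contraNneq kr => ->.
Qed.

(** Jacobi's formula. [Mi] is [M] with row [i] differentiated; expanding its determinant along that
    row yields the [i]-th diagonal entry, as the cofactors do not see row [i]. *)
Lemma deriv_det n (M : 'M[{poly R}]_n) :
  (\det M)^`() = \tr (map_mx (@deriv R) M *m \adj M).
Proof.
have dsgn (b : bool) (q : {poly R}) : ((-1) ^+ b * q)^`() = (-1) ^+ b * q^`().
  by case: b; rewrite ?expr0 ?expr1 ?mul1r ?mulN1r ?derivN.
rewrite /determinant raddf_sum /=.
under eq_bigr => s _ do rewrite dsgn deriv_prod mulr_sumr.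
rewrite exchange_big /mxtrace; apply: eq_bigr => i _ /=.
pose Mi := \matrix_(k, j) (if k == i then (M i j)^`() else M k j).
transitivity (\det Mi).
  apply: eq_bigr => s _; congr (_ * _); rewrite [RHS](bigD1 i) //= mxE eqxx.
  by congr (_ * _); apply: eq_bigr => j ji; rewrite mxE (negPf ji).
rewrite (expand_det_row _ i) mxE; apply: eq_bigr => j _.
rewrite !mxE eqxx; congr (_ * _); rewrite /cofactor; congr (_ * \det _).
by apply/matrixP=> a b; rewrite !mxE eq_sym (negPf (neq_lift _ _)).
Qed.

Lemma deriv_char_poly n (A : 'M[R]_n) :
  (char_poly A)^`() = \tr (\adj (char_poly_mx A)).
Proof.
rewrite /char_poly deriv_det [map_mx _ _](_ : _ = 1%:M) ?mul1mx //.
apply/matrixP=> i j; rewrite !mxE derivB derivC subr0.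
by case: (i == j); rewrite ?mulr1n ?mulr0n ?derivX // -[0]/(0%:P) derivC.
Qed.

Lemma size_det_linear n (M : 'M[{poly R}]_n) :
  (forall i j, size (M i j) <= 2)%N -> (size (\det M) <= n.+1)%N.
Proof.
move=> hM; apply: leq_trans (size_sum _ _ _) _; apply/bigmax_leqP=> s _.
rewrite size_Msign; apply: leq_trans (size_poly_prod_leq _ _) _.
have: (\sum_(i < n) size (M i (s i)) <= \sum_(i < n) 2)%N by apply: leq_sum.
rewrite sum_nat_const !cardT -!cardE card_ord => h.
by rewrite leq_subLR addnS ltnS addnn -muln2.
Qed.

(** Cofactors of X - A are minors of order n - 1 with linear entries. The bound makes the remainder
    term in [newton_char_poly] invisible in degree n. *)
Lemma size_tr_adj_char_poly_mx n (A B : 'M[R]_n) :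
  (size (\tr (\adj (char_poly_mx A) *m map_mx polyC B)) <= n)%N.
Proof.
case: n A B => [|n] A B; first by rewrite /mxtrace big_ord0 size_poly0.
apply: leq_trans (size_sum _ _ _) _; apply/bigmax_leqP=> i _.
rewrite mxE; apply: leq_trans (size_sum _ _ _) _; apply/bigmax_leqP=> j _.
rewrite !mxE mulrC mul_polyC; apply: leq_trans (size_scale_leq _ _) _.
rewrite /cofactor -signr_odd size_Msign.
apply: size_det_linear => k l; rewrite !mxE.
case: (_ == _); rewrite ?mulr1n ?mulr0n.
  by rewrite size_XsubC.
by rewrite sub0r size_polyN size_polyC; case: (_ == _).
Qed.

Lemma map_mx_exp (S : comNzRingType) (f : {rmorphism R -> S}) n (A : 'M[R]_n) k :
  map_mx f (A ^+ k) = map_mx f A ^+ k.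
Proof.
elim: k => [|k IH]; first by rewrite !expr0 [LHS]map_mx1.
by rewrite !exprS -IH; apply: map_mxM.
Qed.

Lemma scalar_mx_exp n (a : R) k : (a%:M : 'M[R]_n) ^+ k = (a ^+ k)%:M.
Proof.
elim: k => [|k IH]; first by rewrite !expr0.
by rewrite !exprS IH scalar_mxM.
Qed.

End MatrixPolynomials.

(* from adj(X - A) (X^N - A^N) = char_poly A * sum_k X^(N-1-k) A^k, N = i + 1 *)
Lemma newton_char_poly (R : comNzRingType) n (A : 'M[R]_n) i : (i <= n)%N ->
  (char_poly A)`_(n - i) *+ (n - i) =
  \sum_(j < i.+1) (char_poly A)`_(n - (i - j)) * \tr (A ^+ j).
Proof.
move=> le_in; pose P := char_poly A; pose M := char_poly_mx A.
have key : 'X^(i.+1) * P^`() - \tr (\adj M *m map_mx polyC (A ^+ i.+1)) =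
    P * \sum_(j < i.+1) 'X^(i - j) * (\tr (A ^+ j))%:P.
  have /(congr1 (fun Z => \tr (\adj M *m Z))) :=
    @subrXX_comm _ ('X%:M : 'M[{poly R}]_n) (map_mx polyC A) i.+1
      (esym (scalar_mxC _ _)).
  rewrite -!mulmxE mulmxA mul_adj_mx mul_scalar_mx linearZ /= -/(char_poly A) -/P.
  rewrite mulmxBr raddfB /= -map_mx_exp scalar_mx_exp scalar_mxC mul_scalar_mx.
  rewrite linearZ /= -deriv_char_poly -/P => ->; congr (_ * _).
  rewrite raddf_sum; apply: eq_bigr => j _ /=.
  rewrite scalar_mx_exp mul_scalar_mx linearZ /= -map_mx_exp.
  by rewrite trace_map_mx.
have := congr1 (fun q : {poly R} => q`_n) key.
rewrite coefB [X in _ - X]nth_default ?size_tr_adj_char_poly_mx // subr0.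
rewrite mulr_sumr coef_sum coefXnM.
under [X in _ = X -> _]eq_bigr => j _ do
  rewrite mulrA coefMC coefMXn ltnNge (leq_trans (leq_subr _ _) le_in) /=.
(* For [i = n] the coefficient of X^n in X^(n+1) P' is zero, matching the multiplicity
   [n - i = 0]. *)
move=> <-; case: ltnP => [|lt_in]; first by rewrite ltnS -subn_eq0 => /eqP ->.
by rewrite coef_deriv -(subnSK lt_in).
Qed.

(** * Witt coordinates *)

Section WittCoordinates.
Variables (R : comNzRingType) (N : nat).
Implicit Types (f g p q S T : {poly R}) (x y : nat -> R).

(** Vanishing modulo t^(N+1): power series are treated as polynomials up to this order. *)
Definition tzero p := forall i, (i <= N)%N -> p`_i = 0.

Lemma tzeroD p q : tzero p -> tzero q -> tzero (p + q).
Proof. by move=> hp hq i iN; rewrite coefD hp // hq // addr0. Qed.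

Lemma tzeroN p : tzero p -> tzero (- p).
Proof. by move=> hp i iN; rewrite coefN hp // oppr0. Qed.

Lemma tzeroMr p q : tzero p -> tzero (p * q).
Proof.
move=> hp i iN; rewrite coefM big1 // => j _.
by rewrite hp ?mul0r // (leq_trans _ iN) // -ltnS.
Qed.

(* [S] is the truncation at order [N] of the power series [- t f'(t) / f(t)] *)
Definition log_deriv f S := tzero ('X * f^`() + f * S).

Lemma log_derivM f g S T :
  log_deriv f S -> log_deriv g T -> log_deriv (f * g) (S + T).
Proof.
move=> hf hg; rewrite /log_deriv derivM.
have -> : 'X * (f^`() * g + f * g^`()) + f * g * (S + T)
   = ('X * f^`() + f * S) * g + ('X * g^`() + g * T) * f by ring.
by apply: tzeroD; apply: tzeroMr.
Qed.

Lemma log_deriv_prod I (r : seq I) (f S : I -> {poly R}) :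
  (forall i, log_deriv (f i) (S i)) ->
  log_deriv (\prod_(i <- r) f i) (\sum_(i <- r) S i).
Proof.
move=> h; elim/big_rec2: _ => [|i p q _ IH]; last exact: log_derivM.
by move=> i _; rewrite /log_deriv -[1]/(1%:P) derivC !mulr0 addr0 coef0.
Qed.

(** Differentiation loses one order of precision, and the factor ['X] in [log_deriv] restores it. *)
Lemma log_deriv_eq f g S : tzero (f - g) -> log_deriv f S -> log_deriv g S.
Proof.
move=> hfg hf; rewrite /log_deriv.
have -> : 'X * g^`() + g * S = ('X * f^`() + f * S) - ('X * (f - g)^`())
   - (f - g) * S by rewrite derivB; ring.
apply/tzeroD/tzeroN/tzeroMr => //; apply/tzeroD/tzeroN => //.
case=> [|i] iN; rewrite coefXM //= coef_deriv.
by rewrite hfg // mul0rn.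
Qed.

(** Here f (S - T) vanishes to order N, and since f has constant term 1 the coefficients of S - T
    vanish one after another. *)
Lemma log_deriv_uniq f S T : f`_0 = 1 -> log_deriv f S -> log_deriv f T ->
  forall i, (i <= N)%N -> S`_i = T`_i.
Proof.
move=> f0 hS hT.
have hD : tzero (f * (S - T)).
  have -> : f * (S - T) = ('X * f^`() + f * S) - ('X * f^`() + f * T) by ring.
  exact/tzeroD/tzeroN.
move=> i; elim/ltn_ind: i => i IH iN; apply/eqP; rewrite -subr_eq0 -coefB.
have := hD i iN; rewrite coefM big_ord_recl /= f0 mul1r subn0 big1 ?addr0.
  by move->.
move=> j _; rewrite coefB IH ?subrr ?mulr0 //=.
  by rewrite /bump /=; have := ltn_ord j; lia.
exact: leq_trans (leq_subr _ _) iN.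
Qed.

Definition witt_prod x (n : nat) := \prod_(1 <= m < n.+1) (1 - x m *: 'X^m).

(** For 0 < n <= N this is the ghost component of a big Witt vector, the sum of m x_m^(n/m) over the
    divisors m of n. *)
Definition ghost x n :=
  \sum_(1 <= m < N.+1) \sum_(1 <= k < N.+1 | (m * k)%N == n) x m ^+ k *+ m.

(** With Y = a t^m the series is m Y / (1 - Y), a geometric series; cutting it after N terms leaves
    the error - m Y^(N+1), of order beyond N. *)
Lemma log_deriv_factor (a : R) m : (0 < m)%N ->
  log_deriv (1 - a *: 'X^m) (\sum_(1 <= k < N.+1) (a ^+ k *+ m) *: 'X^(m * k)).
Proof.
move=> m0; set Y := a *: 'X^m.
have -> : \sum_(1 <= k < N.+1) (a ^+ k *+ m) *: 'X^(m * k)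
        = (\sum_(k < N) Y ^+ k) * Y * m%:R.
  rewrite big_add1 /= big_mkord !mulr_suml; apply: eq_bigr => k _.
  by rewrite -exprSr /Y exprZn -exprM -scalerMnl mulr_natr.
have XY' : 'X * (1 - Y)^`() = - (Y * m%:R).
  rewrite derivB -[1]/(1%:P) derivC sub0r mulrN /Y derivZ derivXn.
  by rewrite mulr_natr -scalerAr mulrnAr -exprS prednK // scalerMnr.
rewrite /log_deriv XY'.
rewrite -(mulrA _ Y) (mulrA (1 - Y)).
have -> : (1 - Y) * (\sum_(k < N) Y ^+ k) = 1 - Y ^+ N.
  by rewrite -opprB mulNr -subrX1 opprB.
move=> i iN; have -> : - (Y * m%:R) + (1 - Y ^+ N) * (Y * m%:R)
   = - (Y ^+ N.+1 * m%:R) by rewrite exprSr; ring.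
rewrite coefN mulr_natr coefMn /Y exprZn -exprM coefZ coefXn.
case: eqP => [e|]; last by rewrite mulr0 mul0rn oppr0.
by move: iN; rewrite e; nia.
Qed.

Lemma log_deriv_witt_prod x :
  log_deriv (witt_prod x N)
    (\sum_(1 <= m < N.+1) \sum_(1 <= k < N.+1) (x m ^+ k *+ m) *: 'X^(m * k)).
Proof.
rewrite /witt_prod !(big_add1 _ _ 0%N) /=.
by apply: log_deriv_prod => m; apply: log_deriv_factor.
Qed.

Lemma coef_ghost x n :
  (\sum_(1 <= m < N.+1) \sum_(1 <= k < N.+1) (x m ^+ k *+ m) *: 'X^(m * k))`_n
  = ghost x n.
Proof.
rewrite coef_sum; apply: eq_bigr => m _.
rewrite coef_sum [RHS]big_mkcond; apply: eq_bigr => k _.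
by rewrite coefZ coefXn eq_sym; case: (_ == _); rewrite ?mulr1 ?mulr0.
Qed.

End WittCoordinates.

(** * Existence and uniqueness of Witt coordinates, and traces as ghost components *)

Section WittExistence.
Variable R : comNzRingType.
Implicit Types (f : {poly R}) (x y : nat -> R).

Lemma witt_prodS x N :
  witt_prod x N.+1 = witt_prod x N * (1 - x N.+1 *: 'X^(N.+1)).
Proof. by rewrite /witt_prod big_nat_recr. Qed.

Lemma eq_witt_prod x y N : (forall n, (0 < n <= N)%N -> x n = y n) ->
  witt_prod x N = witt_prod y N.
Proof. by move=> h; apply: eq_big_nat => m hm; rewrite h. Qed.

Lemma coef0_witt_prod x N : (witt_prod x N)`_0 = 1.
Proof.
elim: N => [|N IH]; first by rewrite /witt_prod big_geq // coef1.
by rewrite witt_prodS coef0M IH mul1r coefB coefZ coefXn mulr0 coef1 subr0.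
Qed.

(** Triangularity: the new factor affects only the top coefficient, by [- x N.+1]. Existence and
    uniqueness of the coordinates both follow by induction. *)
Lemma coef_witt_prodS x N i : (i <= N.+1)%N ->
  (witt_prod x N.+1)`_i = (witt_prod x N)`_i - (if i == N.+1 then x i else 0).
Proof.
move=> iN; rewrite witt_prodS mulrBr mulr1 coefB -scalerAr coefZ coefMXn.
congr (_ - _); case: ltngtP iN => // [iN _|-> _]; first by rewrite mulr0.
by rewrite subnn coef0_witt_prod mulr1.
Qed.

Lemma witt_prod_exists N f : f`_0 = 1 ->
  exists x, forall i, (i <= N)%N -> f`_i = (witt_prod x N)`_i.
Proof.
move=> f0; elim: N => [|N [x IH]].
  by exists (fun=> 0) => -[|//] _; rewrite coef0_witt_prod.
pose c := (witt_prod x N)`_(N.+1) - f`_(N.+1).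
exists (fun n => if n == N.+1 then c else x n) => i iN.
rewrite coef_witt_prodS // (@eq_witt_prod _ x); last first.
  by move=> n /andP[_ nN]; rewrite ltn_eqF.
case: eqP => [->|/eqP ne]; first by rewrite /c subKr.
by rewrite subr0 IH // -ltnS ltn_neqAle ne.
Qed.

Lemma witt_prod_inj N x y :
  (forall i, (i <= N)%N -> (witt_prod x N)`_i = (witt_prod y N)`_i) ->
  forall n, (0 < n <= N)%N -> x n = y n.
Proof.
elim: N => [|N IH] h n; first by case: n.
have {}IH : forall n, (0 < n <= N)%N -> x n = y n.
  apply: IH => i iN; have := h i (leqW iN).
  by rewrite !coef_witt_prodS ?leqW // ltn_eqF // !subr0.
case/andP=> n0; rewrite leq_eqVlt => /orP[/eqP->|nN]; last by rewrite IH ?n0.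
have := h N.+1 (leqnn _); rewrite !coef_witt_prodS // eqxx (eq_witt_prod IH).
by move/addrI/oppr_inj.
Qed.

Lemma map_witt_prod (S : comNzRingType) (h : {rmorphism R -> S}) x N :
  map_poly h (witt_prod x N) = witt_prod (h \o x) N.
Proof.
rewrite /witt_prod rmorph_prod; apply: eq_bigr => m _ /=.
by rewrite rmorphB rmorph1 /= map_polyZ map_polyXn.
Qed.

(** This is det(1 - tA). *)
Definition rev_char_poly n (A : 'M[R]_n) :=
  \poly_(i < n.+1) (char_poly A)`_(n - i).

Lemma coef0_rev_char_poly n (A : 'M[R]_n) : (rev_char_poly A)`_0 = 1.
Proof.
rewrite coef_poly /= subn0 -[n in _`_n]/(n.+1.-1) -(size_char_poly A).
exact: (monicP (char_poly_monic A)).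
Qed.

(** Newton's identities as a generating function; the factor [(0 < i)] removes the trace of
    [A ^+ 0], which is n. *)
Lemma log_deriv_rev_char_poly n (A : 'M[R]_n) :
  log_deriv n (rev_char_poly A) (\poly_(i < n.+1) (\tr (A ^+ i) *+ (0 < i))).
Proof.
move=> i iN; rewrite coefD coefXM coefMr; set P := char_poly A.
have := newton_char_poly A iN; rewrite -/P big_ord_recl /= expr0 mxtrace1 subn0.
rewrite mulr_natr => E.
rewrite big_ord_recl /= subn0 [X in _ * X]coef_poly /= mulr0n mulr0 add0r.
have -> : \sum_(j < i) (rev_char_poly A)`_(i - bump 0 j) *
    (\poly_(k < n.+1) (\tr (A ^+ k) *+ (0 < k)%N))`_(bump 0 j)
   = \sum_(j < i) P`_(n - (i - bump 0 j)) * \tr (A ^+ bump 0 j).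
  apply: eq_bigr => j _; have := ltn_ord j; rewrite /bump /= add1n => ji.
  rewrite !coef_poly mulr1n !ifT //; lia.
have /eqP := E; rewrite eq_sym addrC -subr_eq0 => /eqP.
have -> : (if i == 0%N then 0 else (rev_char_poly A)^`()`_i.-1) = P`_(n - i) *+ i.
  by case: i iN {E} => [|i] iN; rewrite ?mulr0n //= coef_deriv coef_poly ltnS iN.
move=> E'; rewrite -[RHS]E' -[RHS]addrA [LHS]addrC; congr (_ + _).
(* The term [j = 0] of Newton's identity has multiplicity n; less the [n - i] of the other side, it
   leaves the [i] produced by the derivative. *)
by rewrite -mulrnBr ?leq_subr // subKn.
Qed.

Lemma trace_ghost n (A : 'M[R]_n) x :
  (forall i, (i <= n)%N -> (rev_char_poly A)`_i = (witt_prod x n)`_i) ->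
  forall k, (0 < k <= n)%N -> \tr (A ^+ k) = ghost n x k.
Proof.
move=> hx k /andP[k0 kn].
have hA : log_deriv n (witt_prod x n) (\poly_(i < n.+1) (\tr (A ^+ i) *+ (0 < i))).
  apply: log_deriv_eq (log_deriv_rev_char_poly A) => i iN.
  by rewrite coefB hx // subrr.
have := log_deriv_uniq (coef0_witt_prod x n) hA (@log_deriv_witt_prod R n x) kn.
by rewrite coef_ghost coef_poly ltnS kn k0.
Qed.

End WittExistence.

(** * Congruences *)

(** The inner binomial coefficients are divisible by p, and each inner term also contains z;
    [exp_p_congr] needs both factors. *)
Lemma exprD_prime (R : comNzRingType) p (y z : R) : prime p ->
  exists b, (y + z) ^+ p = y ^+ p + z ^+ p + p%:R * (z * b).
Proof.
case: p => // q pr_p.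
exists (\sum_(i < q) y ^+ (q - i) * z ^+ i *+ ('C(q.+1, i.+1) %/ q.+1)).
rewrite exprDn big_ord_recl big_ord_recr /= subn0 subnn !expr0 mulr1 mul1r.
rewrite bin0 binn !mulr1n -[RHS]addrA; congr (_ + _); rewrite addrC; congr (_ + _).
rewrite !mulr_sumr; apply: eq_bigr => i _; rewrite /bump /= add1n subSS.
have /divnK e1 : (q.+1 %| 'C(q.+1, i.+1))%N.
  by apply: prime_dvd_bin => //; have := ltn_ord i; lia.
by rewrite -{1}e1 mulrnA mulr_natl mulrnAr mulrCA -exprS.
Qed.

Section Congruences.
Variables (O : idomainType) (F : finFieldType).
Variables (red : {rmorphism O -> F}) (pi : O) (p e : nat).
Hypotheses (hO : padic_integer_ring red pi p e) (le_e : (e <= p.-1)%N).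

Let red_eqP x y : red x = red y <-> exists a, x - y = pi * a.
Proof.
have [_ _ _ [_ h] _] := hO; rewrite -h rmorphB; split=> [->|/eqP].
  by rewrite subrr.
by rewrite subr_eq0 => /eqP.
Qed.

Lemma unit_of_red_neq0 x : red x != 0 -> x \is a GRing.unit.
Proof.
have [_ [_ _ hu] _ [_ hr] _] := hO => hx.
have x0 : x != 0 by apply: contraNneq hx => ->; rewrite rmorph0.
have [u [[|k] [uu ex]]] := hu x x0; first by rewrite ex expr0 mulr1.
case/eqP: hx; apply/hr; exists (u * pi ^+ k).
by rewrite ex exprS mulrCA.
Qed.

(** This is where the bound e <= p - 1 enters. *)
Lemma p_dvd_pi_exp : exists c, pi ^+ p.-1 = p%:R * c.
Proof.
have [_ _ _ _ [_ _ [u [uu ep]]]] := hO.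
exists (u^-1 * pi ^+ (p.-1 - e)); rewrite ep mulrACA mulrV // mul1r -exprD.
by rewrite subnKC.
Qed.

(** Put z = x - y. The mixed terms of (y + z)^p are divisible by p z, and so is z^p, because z^(p-1)
    contains pi^(p-1). The free factor [c] allows iteration. *)
Lemma exp_p_congr x y c : (exists a, x - y = c * (pi * a)) ->
  exists a, x ^+ p - y ^+ p = p%:R * c * (pi * a).
Proof.
have [_ _ _ _ [pr_p _ _]] := hO => -[a exy]; set z := c * (pi * a) in exy.
have -> : x = y + z by rewrite -exy addrC subrK.
have [b ->] := exprD_prime y z pr_p; have [d ed] := p_dvd_pi_exp.
have -> : z ^+ p = p%:R * (z * ((c * a) ^+ p.-1 * d)).
  rewrite -{1}(prednK (prime_gt0 pr_p)) exprS {2}/z [c * _]mulrCA exprMn ed.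
  by rewrite /z; ring.
by exists (a * ((c * a) ^+ p.-1 * d + b)); rewrite /z; ring.
Qed.

(** For k = p^j m with m prime to p, j applications of [exp_p_congr] give the factor p^j; m is a
    unit of O and can be inserted freely. *)
Lemma exp_congr x y k : (0 < k)%N -> red x = red y ->
  exists a, x ^+ k - y ^+ k = k%:R * (pi * a).
Proof.
move=> k0 /red_eqP hxy; have [_ _ _ _ [pr_p Fp0 _]] := hO.
have [m co_pm ek] := pfactor_coprime pr_p k0.
have {ek} [j ek] : exists j, k = (p ^ j * m)%N by exists (logn p k); rewrite mulnC.
have [a ea] : exists a, x ^+ (p ^ j) - y ^+ (p ^ j) = (p ^ j)%:R * (pi * a).
  elim: (j) => [|i IH]; first by case: hxy => a ea; exists a; rewrite expn0 mul1r.
  have [a ea] := exp_p_congr IH.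
  by exists a; rewrite expnSr !exprM ea natrM [p%:R * _]mulrC.
have um : (m%:R : O) \is a GRing.unit.
  apply: unit_of_red_neq0; rewrite rmorph_nat.
  have chF : p \in [pchar F] by rewrite inE pr_p Fp0 eqxx.
  by rewrite -(dvdn_pcharf chF) -prime_coprime.
exists (a * (\sum_(i < m) (x ^+ (p ^ j)) ^+ (m.-1 - i) * (y ^+ (p ^ j)) ^+ i) / m%:R).
rewrite ek !exprM subrXX ea natrM; set s := \sum_(i < m) _.
set w := (p ^ j)%:R; move: um; set u := m%:R => um.
transitivity (w * (pi * a) * s * (u * u^-1)); first by rewrite mulrV // mulr1.
by move: (u^-1) => v; ring.
Qed.

Lemma ghost_term_congr x y m k : (0 < k)%N -> red x = red y ->
  exists a, x ^+ k *+ m - y ^+ k *+ m = (m * k)%:R * (pi * a).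
Proof.
move=> k0 h; have [a ea] := exp_congr k0 h; exists a.
by rewrite -mulrnBl ea natrM -mulrA [RHS]mulr_natl.
Qed.

Lemma sum_congr0 (I : Type) (r : seq I) (P : pred I) (f : I -> O) n :
  (forall i, P i -> exists a, f i = n%:R * (pi * a)) ->
  exists a, \sum_(i <- r | P i) f i = n%:R * (pi * a).
Proof.
move=> h; elim/big_ind: _ => //.
- by exists 0; rewrite !mulr0.
- by move=> _ _ [a ->] [b ->]; exists (a + b); rewrite !mulrDr.
Qed.

(* all the terms of the ghost component but [x n *+ n] involve earlier
   coordinates only *)
Lemma ghost_congr N x y n : (0 < n <= N)%N ->
  (forall m, (0 < m < n)%N -> red (x m) = red (y m)) ->
  exists a, ghost N x n - ghost N y n = n%:R * (x n - y n + pi * a).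
Proof.
move=> /andP[n0 nN] h; rewrite /ghost.
rewrite -sumrB (bigD1_seq n) ?iota_uniq ?mem_index_iota ?n0 //=.
have diag (z : nat -> O) :
    \sum_(1 <= k < N.+1 | (n * k)%N == n) z n ^+ k *+ n = z n *+ n.
  rewrite big_mkcond (bigD1_seq 1%N) ?iota_uniq //=; last first.
    by rewrite mem_index_iota; lia.
  rewrite muln1 eqxx expr1 big1 ?addr0 // => k k1.
  by rewrite -{2}[n]muln1 eqn_pmul2l // (negPf k1).
rewrite !diag -mulrnBl.
have [a ->] : exists a, \sum_(1 <= m < N.+1 | m != n)
    (\sum_(1 <= k < N.+1 | (m * k)%N == n) x m ^+ k *+ m -
     \sum_(1 <= k < N.+1 | (m * k)%N == n) y m ^+ k *+ m) = n%:R * (pi * a).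
  apply: sum_congr0 => m ne_mn; rewrite -sumrB; apply: sum_congr0 => k /eqP emk.
  have [m0 k0] : (0 < m)%N /\ (0 < k)%N by lia.
  rewrite -emk; apply: ghost_term_congr => //; apply: h; nia.
by exists a; rewrite mulrDr [X in _ = X + _]mulr_natl.
Qed.

Lemma ghost_congrP N x y :
  (forall n, (0 < n <= N)%N -> red (x n) = red (y n)) <->
  (forall n, (0 < n <= N)%N ->
     exists a, ghost N x n - ghost N y n = n%:R * (pi * a)).
Proof.
split=> h n hn.
  have [a ->] : exists a, ghost N x n - ghost N y n = n%:R * (x n - y n + pi * a).
    by apply: ghost_congr => // m hm; apply: h; lia.
  have /red_eqP[b ->] := h n hn.
  by exists (b + a); rewrite [in RHS]mulrDr.
elim/ltn_ind: n hn => n IH hn.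
have [a ea] : exists a, ghost N x n - ghost N y n = n%:R * (x n - y n + pi * a).
  by apply: ghost_congr => // m hm; apply: IH; lia.
have [b eb] := h n hn; apply/red_eqP; exists (b - a).
have [char0O _ _ _ _] := hO.
(* Characteristic 0 allows n to be cancelled, leaving a congruence modulo pi. *)
have n0 : (n%:R : O) != 0 by apply/eqP => /char0O; lia.
have /(mulfI n0) : n%:R * (x n - y n + pi * a) = n%:R * (pi * b) by rewrite -ea.
by rewrite mulrBr => <-; rewrite addrK.
Qed.

Theorem trace_congrP d (A B : 'M[O]_d) :
  char_poly (map_mx red A) = char_poly (map_mx red B) <->
  (forall n : nat, (1 <= n <= d)%N ->
     exists a : O, \tr (A ^+ n) - \tr (B ^+ n) = n%:R * (pi * a)).
Proof.
have [x hx] := witt_prod_exists d (coef0_rev_char_poly A).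
have [y hy] := witt_prod_exists d (coef0_rev_char_poly B).
have red_coef (C : 'M[O]_d) z i : (i <= d)%N ->
    (forall i, (i <= d)%N -> (rev_char_poly C)`_i = (witt_prod z d)`_i) ->
    (char_poly (map_mx red C))`_(d - i) = (witt_prod (red \o z) d)`_i.
  move=> iN hz; rewrite -map_witt_prod coef_map -hz // coef_poly ltnS iN.
  by rewrite -map_char_poly coef_map.
(* Reduced coordinates are the coordinates of the reduced polynomial, so uniqueness over [F] gives
   the forward implication. *)
have -> : char_poly (map_mx red A) = char_poly (map_mx red B) <->
    (forall n, (0 < n <= d)%N -> red (x n) = red (y n)).
  split=> [eqAB|exy].
    apply: (@witt_prod_inj _ d (red \o x) (red \o y)) => i iN.
    by rewrite -(red_coef A) // -(red_coef B) // eqAB.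
  apply/polyP => i; have [iN|iN] := leqP i d; last first.
    by rewrite !nth_default // size_char_poly.
  rewrite -(subKn iN) (red_coef A x) ?leq_subr // (red_coef B y) ?leq_subr //.
  by rewrite (@eq_witt_prod _ (red \o x) (red \o y)).
rewrite ghost_congrP; split=> h n hn; have := h n hn.
  by rewrite (trace_ghost hx) // (trace_ghost hy).
by rewrite (trace_ghost hx) // (trace_ghost hy).
Qed.

End Congruences.

Theorem theorem6p1 (O : idomainType) (F : finFieldType)
    (red : {rmorphism O -> F}) (pi : O) (p e : nat) :
  padic_integer_ring red pi p e -> (e <= p.-1)%N ->
  forall (d : nat) (A B : 'M[O]_d),
    ss_iso (map_mx red A) (map_mx red B) <->
    (forall n : nat, (1 <= n <= d)%N ->
       exists a : O, \tr (A ^+ n) - \tr (B ^+ n) = n%:R * (pi * a)).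
Proof.
by move=> hO le_e d A B; rewrite ss_iso_char_poly; apply: trace_congrP hO le_e _ _ _.
Qed.
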